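(* Let $m\ge 1$, let $\lambda=(\lambda_1,\dots,\lambda_m)$ and $\mu=(\mu_1,\dots,\mu_m)$ be two partitions of length $m$ and set $n=\max(\lambda_1,\mu_1)$. Put $\widehat{\lambda}=(n-\lambda_m,\dots,n-\lambda_1)$, $\widehat{\mu}=(n-\mu_m,\dots,n-\mu_1)$ and $\kappa_m=(1,\dots,1)\in\mathbb{Z}^m$. Let $k$ be any integer such that $k\ge \frac{|\mu|-|\lambda|}{2}$ (and such that $\widehat{\lambda}+k\kappa_m$ and $\widehat{\mu}+k\kappa_m$ are partitions). Then $\widehat{\lambda}$ and $\widehat{\mu}$ are partitions of length $m$ and $$u_{\lambda,\mu}(q)=K^{D_m}_{\widehat{\lambda}+k\kappa_m,\ \widehat{\mu}+k\kappa_m}(q),\qquad U_{\lambda,\mu}(q)=K^{C_m}_{\widehat{\lambda}+k\kappa_m,\ \widehat{\mu}+k\kappa_m}(q).$$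
   Context: A partition of length $m$ is a sequence $\lambda_1\ge\dots\ge\lambda_m\ge 0$ of integers (zero parts allowed). $\varepsilon_1,\dots,\varepsilon_m$ is the standard basis of $\mathbb{Z}^m$, $|\alpha|=\alpha_1+\dots+\alpha_m$ for $\alpha\in\mathbb{Z}^m$, and $\rho_m=(m,m-1,\dots,1)$. The symmetric group $\mathcal{S}_m$ acts on $\mathbb{Z}^m$ by permuting coordinates; $l$ denotes Coxeter length. Functions $f_q,F_q$ on $\mathbb{Z}^m$: they are defined by the expansions (each factor expanded as a geometric series in $q\,x_i/x_j$ or $q/(x_rx_s)$) $$\prod_{1\le i<j\le m}\frac{1}{1-q\frac{x_i}{x_j}}\prod_{1\le r<s\le m}\frac{1}{1-\frac{q}{x_rx_s}}=\sum_{\alpha\in\mathbb{Z}^m}f_q(\alpha)x^\alpha,\qquad \prod_{1\le i<j\le m}\frac{1}{1-q\frac{x_i}{x_j}}\prod_{1\le r\le s\le m}\frac{1}{1-\frac{q}{x_rx_s}}=\sum_{\alpha\in\mathbb{Z}^m}F_q(\alpha)x^\alpha .$$ For partitions $\lambda,\mu$ of length $m$: $$u_{\lambda,\mu}(q)=\sum_{\sigma\in\mathcal{S}_m}(-1)^{l(\sigma)}f_q(\sigma(\lambda+\rho_m)-\mu-\rho_m),\qquad U_{\lambda,\mu}(q)=\sum_{\sigma\in\mathcal{S}_m}(-1)^{l(\sigma)}F_q(\sigma(\lambda+\rho_m)-\mu-\rho_m).$$ Kostka-Foulkes polynomials: the positive roots are $R^+_{C_m}=\{\varepsilon_i\pm\varepsilon_j: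 1\le i<j\le m\}\cup\{2\varepsilon_i:1\le i\le m\}$ and $R^+_{D_m}=\{\varepsilon_i\pm\varepsilon_j: 1\le i<j\le m\}$; $\rho_{C_m}=(m,m-1,\dots,1)$, $\rho_{D_m}=(m-1,m-2,\dots,0)$. $W_{C_m}$ is the group of all signed permutations of coordinates, $W_{D_m}$ its subgroup of elements changing an even number of signs, each with its Coxeter length $l$. For $g=C_m$ or $D_m$, the $q$-Kostant partition function is defined by $\prod_{\alpha\in R_g^+}\frac{1}{1-qx^\alpha}=\sum_{\beta\in\mathbb{Z}^m}\mathcal{P}_q^{g}(\beta)x^\beta$, and for partitions $\nu,\eta$ of length $m$, $$K^{g}_{\nu,\eta}(q)=\sum_{w\in W_g}(-1)^{l(w)}\mathcal{P}^g_q(w(\nu+\rho_g)-(\eta+\rho_g)).$$ *)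

(* Defs.v *)
From mathcomp Require Import all_boot all_order all_algebra all_fingroup.
From mathcomp Require Import zify.

Set Implicit Arguments.
Unset Strict Implicit.
Unset Printing Implicit Defensive.

Import Order.TTheory GRing.Theory Num.Theory.
Local Open Scope ring_scope.

Definition is_partition m (lam : 'rV[int]_m) : Prop :=
  (forall i j : 'I_m, (i <= j)%N -> lam 0 j <= lam 0 i) /\
  (forall i : 'I_m, 0 <= lam 0 i).

Definition wt m (v : 'rV[int]_m) : int := \sum_i v 0 i.

Definition eps m (i : 'I_m) : 'rV[int]_m := delta_mx 0 i.

Definition kappa m : 'rV[int]_m := const_mx 1.

Definition rho m : 'rV[int]_m := \row_(i < m) (m - i)%N%:Z.

Definition rhoD m : 'rV[int]_m := \row_(i < m) (m - i.+1)%N%:Z.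

Definition hat m (n : int) (lam : 'rV[int]_m) : 'rV[int]_m :=
  \row_(i < m) (n - lam 0 (rev_ord i)).

(* A formal series in x_1, ..., x_m and q is the function sending (beta, d)   *)
(* to the coefficient of x^beta q^d.                                          *)
Definition series m := 'rV[int]_m -> nat -> int.

(* Product with 1 / (1 - q x^a) = \sum_k q^k x^(k a); the coefficient of q^d  *)
(* only involves the terms k <= d.                                            *)
Definition mul_geom m (a : 'rV[int]_m) (G : series m) : series m :=
  fun b d => \sum_(k < d.+1) G (b - a *+ k) (d - k)%N.

(* \prod_(a <- R) 1 / (1 - q x^a) *)
Definition expansion m (R : seq 'rV[int]_m) : series m :=
  foldr (@mul_geom m) (fun b d => ((b == 0) && (d == 0%N))%:R) R.

(* The coefficient of x^b in the expansion, as a polynomial in q. The bound   *)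
(* on the degree loses nothing for the four lists of exponents used here: see *)
(* coef_f, coef_F, coef_PD and coef_PC below.                                 *)
Definition xcoef m (R : seq 'rV[int]_m) (b : 'rV[int]_m) : {poly int} :=
  \poly_(d < (m * \sum_i `|b ord0 i|).+1) expansion R b d.

Definition exps_diff m : seq 'rV[int]_m :=
  [seq eps p.1 - eps p.2 | p in [pred p : 'I_m * 'I_m | (p.1 < p.2)%N]].

Definition exps_sum m : seq 'rV[int]_m :=
  [seq eps p.1 + eps p.2 | p in [pred p : 'I_m * 'I_m | (p.1 < p.2)%N]].

Definition exps_wsum m : seq 'rV[int]_m :=
  [seq eps p.1 + eps p.2 | p in [pred p : 'I_m * 'I_m | (p.1 <= p.2)%N]].

Definition exps_long m : seq 'rV[int]_m := [seq eps i *+ 2 | i : 'I_m].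

Definition exps_f m := exps_diff m ++ [seq - a | a <- exps_sum m].
Definition exps_F m := exps_diff m ++ [seq - a | a <- exps_wsum m].
Definition rootsD m := exps_diff m ++ exps_sum m.
Definition rootsC m := exps_diff m ++ exps_sum m ++ exps_long m.

Definition f_q m (b : 'rV[int]_m) := xcoef (exps_f m) b.
Definition F_q m (b : 'rV[int]_m) := xcoef (exps_F m) b.
Definition PD m (b : 'rV[int]_m) := xcoef (rootsD m) b.
Definition PC m (b : 'rV[int]_m) := xcoef (rootsC m) b.

Lemma word_exists (gT : finGroupType) (S : {set gT}) (w : gT) :
  w \in <<S>>%g -> exists n, w \in (S ^+ n)%g.
Proof.
case/gen_prodgP=> n [c cS ->]; exists n.
elim: n c cS => [|n IHn] c cS; first by rewrite big_ord0 expg0 inE.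
by rewrite big_ord_recl expgS mem_mulg // IHn.
Qed.

(* The length of w with respect to the generating set S: the least n such     *)
(* that w is a product of n elements of S (S ^+ n is a power for the product  *)
(* of sets). The value 0 outside the subgroup generated by S is a default; it *)
(* is not reached below, where 'S_m, weylC m and weylD m are generated by     *)
(* gensA m, gensC m and gensD m.                                              *)
Definition coxlen (gT : finGroupType) (S : {set gT}) (w : gT) : nat :=
  if @idP (w \in <<S>>%g) is ReflectT Sw then ex_minn (word_exists Sw) else 0%N.

Definition gensA m : {set 'S_m} :=
  [set tperm p.1 p.2 | p in [pred p : 'I_m * 'I_m | p.2 == p.1.+1 :> nat]].

(* The i-th coordinate of v moves to position s i. *)
Definition permact m (s : 'S_m) (v : 'rV[int]_m) : 'rV[int]_m :=
  col_perm s^-1%g v.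

(* Signed permutations are permutations of the 2m vectors +-eps_i commuting   *)
(* with negation: (i, false) stands for eps_i and (i, true) for - eps_i.      *)
Notation signed_idx m := ('I_m * bool)%type.

Definition negidx m (p : signed_idx m) : signed_idx m := (p.1, ~~ p.2).

Definition weylC m : {set {perm signed_idx m}} :=
  [set w : {perm signed_idx m} | [forall p, w (negidx p) == negidx (w p)]].

Definition weylD m : {set {perm signed_idx m}} :=
  [set w in weylC m | ~~ odd #|[set i : 'I_m | (w (i, false)).2]|].

(* The linear action: if w (i, b) = (j, false), that is w eps_i = (-1)^b      *)
(* eps_j, then the j-th coordinate of w v is (-1)^b v_i.                      *)
Definition weylact m (w : {perm signed_idx m}) (v : 'rV[int]_m) : 'rV[int]_m :=
  \row_(j < m) (let p := (w^-1)%g (j, false) in (-1) ^+ p.2 * v 0 p.1).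

(* The reflections in eps_i - eps_j, eps_i + eps_j and 2 eps_i. *)
Definition refl_diff m (i j : 'I_m) : {perm signed_idx m} :=
  (tperm (i, false) (j, false) * tperm (i, true) (j, true))%g.

Definition refl_sum m (i j : 'I_m) : {perm signed_idx m} :=
  (tperm (i, false) (j, true) * tperm (i, true) (j, false))%g.

Definition refl_long m (i : 'I_m) : {perm signed_idx m} :=
  tperm (i, false) (i, true).

(* The simple reflections: simple roots eps_i - eps_(i+1) together with       *)
(* 2 eps_m in type C, eps_(m-1) + eps_m in type D (none if m = 1).            *)
Definition gensCD m : {set {perm signed_idx m}} :=
  [set refl_diff p.1 p.2 | p in [pred p : 'I_m * 'I_m | p.2 == p.1.+1 :> nat]].

Definition gensC m : {set {perm signed_idx m}} :=
  gensCD m :|: [set refl_long i | i in [pred i : 'I_m | i.+1 == m :> nat]].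

Definition gensD m : {set {perm signed_idx m}} :=
  gensCD m :|:
  [set refl_sum p.1 p.2 | p
     in [pred p : 'I_m * 'I_m | (p.1.+2 == m :> nat) && (p.2.+1 == m :> nat)]].

Definition u_q m (lam mu : 'rV[int]_m) : {poly int} :=
  \sum_(s : 'S_m) (-1) ^+ coxlen (gensA m) s
     * f_q (permact s (lam + rho m) - mu - rho m).

Definition U_q m (lam mu : 'rV[int]_m) : {poly int} :=
  \sum_(s : 'S_m) (-1) ^+ coxlen (gensA m) s
     * F_q (permact s (lam + rho m) - mu - rho m).

Definition KC m (nu eta : 'rV[int]_m) : {poly int} :=
  \sum_(w in weylC m) (-1) ^+ coxlen (gensC m) w
     * PC (weylact w (nu + rho m) - (eta + rho m)).

Definition KD m (nu eta : 'rV[int]_m) : {poly int} :=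
  \sum_(w in weylD m) (-1) ^+ coxlen (gensD m) w
     * PD (weylact w (nu + rhoD m) - (eta + rhoD m)).

(* (1 - q x^a) * mul_geom a G = G. *)
Lemma mul_geomK m (a : 'rV[int]_m) (G : series m) b :
  mul_geom a G b 0 = G b 0%N /\
  forall d, mul_geom a G b d.+1 - mul_geom a G (b - a) d = G b d.+1.
Proof.
rewrite /mul_geom; split=> [|d].
  by rewrite big_ord_recl big_ord0 addr0 mulr0n subr0.
rewrite big_ord_recl mulr0n subr0 subn0 -[RHS]addr0 -addrA; congr (_ + _).
apply/eqP; rewrite subr_eq0; apply/eqP; apply: eq_bigr => i _.
by rewrite lift0 subSS mulrS opprD addrA.
Qed.

Definition pairing m (c : 'I_m -> int) (b : 'rV[int]_m) : int :=
  \sum_i c i * b 0 i.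

Lemma pairingB m (c : 'I_m -> int) (a b : 'rV[int]_m) :
  pairing c (a - b) = pairing c a - pairing c b.
Proof.
by rewrite /pairing -sumrB; apply: eq_bigr => i _; rewrite !mxE mulrBr.
Qed.

Lemma pairingD m (c : 'I_m -> int) (a b : 'rV[int]_m) :
  pairing c (a + b) = pairing c a + pairing c b.
Proof.
by rewrite /pairing -big_split; apply: eq_bigr => i _; rewrite !mxE mulrDr.
Qed.

Lemma pairingN m (c : 'I_m -> int) (a : 'rV[int]_m) :
  pairing c (- a) = - pairing c a.
Proof.
by rewrite /pairing -sumrN; apply: eq_bigr => i _; rewrite !mxE mulrN.
Qed.

Lemma pairingMn m (c : 'I_m -> int) (a : 'rV[int]_m) k :
  pairing c (a *+ k) = pairing c a *+ k.
Proof.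
elim: k => [|k IHk]; last by rewrite !mulrS pairingD IHk.
by rewrite !mulr0n /pairing big1 // => i _; rewrite mxE mulr0.
Qed.

Lemma pairing_eps m (c : 'I_m -> int) (i : 'I_m) : pairing c (eps i) = c i.
Proof.
rewrite /pairing (bigD1 i) //= mxE !eqxx mulr1 big1 ?addr0 // => j /negbTE ji.
by rewrite mxE ji andbF mulr0.
Qed.

Lemma expansion_deg m (c : 'I_m -> int) (R : seq 'rV[int]_m) b d :
    (forall a, a \in R -> 1 <= pairing c a) ->
  expansion R b d != 0 -> d%:Z <= pairing c b.
Proof.
elim: R b d => [|a R IHR] b d Rpos /=.
  rewrite pnatr_eq0 eqb0 negbK => /andP[/eqP -> /eqP ->].
  by rewrite /pairing big1 // => i _; rewrite mxE mulr0.
rewrite /mul_geom => nz.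
have [k nzk]: exists k : 'I_d.+1, expansion R (b - a *+ k) (d - k)%N != 0.
  apply/existsP; apply: contraNT nz; rewrite negb_exists => /forallP z.
  by rewrite big1 // => k _; apply/eqP; have := z k; rewrite negbK.
have Rpos' a' : a' \in R -> 1 <= pairing c a'.
  by move=> Ra'; apply: Rpos; rewrite inE Ra' orbT.
have a1 : 1 <= pairing c a by apply: Rpos; rewrite inE eqxx.
have := IHR _ _ Rpos' nzk; rewrite pairingB pairingMn -mulr_natr.
have kd := ltn_ord k; move: a1; move: (pairing c a) (pairing c b) => x y.
by rewrite natz; nia.
Qed.

Lemma xcoef_full m (c : 'I_m -> int) (R : seq 'rV[int]_m) b d :
    (forall i, `|c i|%N <= m)%N -> (forall a, a \in R -> 1 <= pairing c a) ->
  (xcoef R b)`_d = expansion R b d.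
Proof.
move=> cm Rpos; rewrite coef_poly; case: ltnP => // le_d.
apply/esym/eqP/negPn/negP => /(expansion_deg Rpos).
apply/negP; rewrite -ltNge.
suff le_pair : pairing c b <= (m * \sum_i `|b ord0 i|)%N%:Z.
  by apply: le_lt_trans le_pair _; rewrite ltz_nat.
rewrite big_distrr /= -natz natr_sum; apply: ler_sum => i _.
apply: le_trans (ler_norm _) _.
by rewrite normrM natz PoszM !abszE ler_wpM2r // -abszE lez_nat.
Qed.

Lemma coef_f m (b : 'rV[int]_m) d : (f_q b)`_d = expansion (exps_f m) b d.
Proof.
apply: (@xcoef_full _ (fun i => - i.+1%:Z)) => [i|a].
  by have := ltn_ord i; lia.
rewrite mem_cat => /orP[/imageP[[i j] ij ->]|/mapP[_ /imageP[[i j] ij ->] ->]];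
  rewrite inE /= in ij;
  rewrite ?pairingN ?pairingB ?pairingD !pairing_eps /=; lia.
Qed.

Lemma coef_F m (b : 'rV[int]_m) d : (F_q b)`_d = expansion (exps_F m) b d.
Proof.
apply: (@xcoef_full _ (fun i => - i.+1%:Z)) => [i|a].
  by have := ltn_ord i; lia.
rewrite mem_cat => /orP[/imageP[[i j] ij ->]|/mapP[_ /imageP[[i j] ij ->] ->]];
  rewrite inE /= in ij;
  rewrite ?pairingN ?pairingB ?pairingD !pairing_eps /=; lia.
Qed.

Lemma coef_PD m (b : 'rV[int]_m) d : (PD b)`_d = expansion (rootsD m) b d.
Proof.
apply: (@xcoef_full _ (fun i => m%:Z - i%:Z)) => [i|a].
  by have := ltn_ord i; lia.
rewrite mem_cat => /orP[] /imageP[[i j] ij ->]; rewrite inE /= in ij;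
  rewrite ?pairingB ?pairingD !pairing_eps /=;
  have := ltn_ord i; have := ltn_ord j; lia.
Qed.

Lemma coef_PC m (b : 'rV[int]_m) d : (PC b)`_d = expansion (rootsC m) b d.
Proof.
apply: (@xcoef_full _ (fun i => m%:Z - i%:Z)) => [i|a].
  by have := ltn_ord i; lia.
rewrite !mem_cat.
case/or3P=> [/imageP[[i j] ij ->]|/imageP[[i j] ij ->]|/imageP[i _ ->]].
- rewrite inE /= in ij; rewrite pairingB !pairing_eps.
  by have := ltn_ord i; have := ltn_ord j; rewrite /=; lia.
- rewrite inE /= in ij; rewrite pairingD !pairing_eps.
  by have := ltn_ord i; have := ltn_ord j; rewrite /=; lia.
by rewrite pairingMn pairing_eps; have := ltn_ord i; lia.
Qed.

(* Main.v *)
(* The linear involution (v_1, ..., v_m) |-> (- v_m, ..., - v_1) carries the   *)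
(* exponents defining f_q (resp. F_q) to the positive roots of type D (resp.  *)
(* C), so f_q and F_q are q-partition functions up to this change of          *)
(* variables, and u, U are the parts of the sums K^D, K^C over the            *)
(* permutations without sign changes. Every other term vanishes: a sign       *)
(* change at a coordinate larger than k lowers the weight by more than 2k,    *)
(* hence makes the weight of the argument negative, whereas all positive      *)
(* roots have nonnegative weight. In type D the last coordinate may equal k,  *)
(* but an even number of sign changes must involve another coordinate.        *)

Require Import Defs.
From mathcomp Require Import all_boot all_order all_algebra all_fingroup.
From mathcomp Require Import zify ring.

Set Implicit Arguments.
Unset Strict Implicit.
Unset Printing Implicit Defensive.

Import Order.TTheory GRing.Theory Num.Theory.
Local Open Scope ring_scope.

(** The identity compares an alternating sum over ['S_m] with one over a Weyl group containing it.
    On the unsigned elements the two sums agree term by term. [f_q_negrev] and [F_q_negrev] rewrite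
    [f_q] and [F_q] as [PD] and [PC] composed with [negrev]; by [hat_rho] and [hat_rhoD], the
    shifted weights on the right are the [negrev] images of [lam + rho m] and [mu + rho m] up to one
    common constant vector, which cancels because permutations fix it. [negrev] turns the action of
    [s] into that of a conjugate of [s], which has the same sign ([sum_perm_negrev]).

    The terms with a sign change vanish by weight ([PD_wt_lt0], [PC_wt_lt0], [wt_flip_lt0]), so
    [sum_weyl_lift] restricts the Weyl sum to ['S_m]. The signs match because the parity of the
    Coxeter length of an unsigned element, in type C or D, is that of the permutation
    ([sign_coxlen_lift]). *)

(** * Products of geometric series *)

Lemma eq_mul_geom m (a : 'rV[int]_m) (G H : series m) :
  G =2 H -> mul_geom a G =2 mul_geom a H.
Proof. by move=> eqGH b d; apply: eq_bigr => k _; rewrite eqGH. Qed.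

Lemma mul_geomC m (a c : 'rV[int]_m) (G : series m) :
  mul_geom a (mul_geom c G) =2 mul_geom c (mul_geom a G).
Proof.
(* Writing the double sum over the triangle [k + l <= d] makes it symmetric in the two factors. *)
have widen x y b d : mul_geom x (mul_geom y G) b d =
    \sum_(k < d.+1) \sum_(l < d.+1 | (k + l <= d)%N)
      G (b - (x *+ k + y *+ l)) (d - (k + l))%N.
  apply: eq_bigr => k _; rewrite /mul_geom.
  rewrite (big_ord_widen d.+1 (fun l => G (b - x *+ k - y *+ l) (d - k - l)%N));
    last by rewrite ltnS leq_subr.
  apply: eq_big => [l|l _]; first by have := ltn_ord k; lia.
  by rewrite opprD addrA subnDA.
move=> b d; rewrite !widen (exchange_big_dep predT) //=.
apply: eq_bigr => k _; apply: eq_big => [l|l _]; first by rewrite addnC.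
by rewrite addnC [a *+ l + _]addrC.
Qed.

Lemma expansion_cat_cons m (a : 'rV[int]_m) (s t : seq 'rV[int]_m) :
  expansion (s ++ a :: t) =2 mul_geom a (expansion (s ++ t)).
Proof.
elim: s => [|c s IHs] //= b d.
by rewrite (eq_mul_geom c IHs) mul_geomC.
Qed.

Lemma perm_expansion m (R S : seq 'rV[int]_m) :
  perm_eq R S -> expansion R =2 expansion S.
Proof.
move=> eqRS b d; apply: (catCA_perm_subst (F := fun T => expansion T b d)) eqRS.
move=> s1 s2 s3; elim: s1 b d => [|a s1 IHs] //= b d.
by rewrite expansion_cat_cons; apply: eq_mul_geom.
Qed.

Lemma expansion_map m (h : 'rV[int]_m -> 'rV[int]_m) (R : seq 'rV[int]_m) b d :
    (forall a c, h (a - c) = h a - h c) -> injective h ->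
  expansion [seq h a | a <- R] (h b) d = expansion R b d.
Proof.
move=> hB h_inj; have h0 : h 0 = 0 by rewrite -[0 in LHS](subrr 0) hB subrr.
have hD a c : h (a + c) = h a + h c.
  by rewrite -{1}[c]opprK hB -[- c]sub0r hB h0 sub0r opprK.
have hMn a k : h (a *+ k) = h a *+ k.
  by elim: k => [|k IHk]; rewrite ?mulr0n // !mulrS hD IHk.
elim: R b d => [|a R IHR] b d /=; first by rewrite -[X in _ == X]h0 (inj_eq h_inj).
by apply: eq_bigr => k _; rewrite -hMn -hB IHR.
Qed.

(** Exponents that occur are nonnegative combinations of elements of [R]. Unlike in [expansion_deg],
    the functional may vanish on some of them, as the weight does on [eps i - eps j]. *)
Lemma expansion_supp m (c : 'I_m -> int) (R : seq 'rV[int]_m) b d :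
    (forall a, a \in R -> 0 <= pairing c a) ->
  expansion R b d != 0 -> 0 <= pairing c b.
Proof.
elim: R b d => [|a R IHR] b d Rpos /=.
  rewrite pnatr_eq0 eqb0 negbK => /andP[/eqP -> _].
  by rewrite /pairing big1 // => i _; rewrite mxE mulr0.
rewrite /mul_geom => nz.
have [k nzk]: exists k : 'I_d.+1, expansion R (b - a *+ k) (d - k)%N != 0.
  apply/existsP; apply: contraNT nz; rewrite negb_exists => /forallP z.
  by rewrite big1 // => k _; apply/eqP; have := z k; rewrite negbK.
have Rpos' a' : a' \in R -> 0 <= pairing c a'.
  by move=> Ra'; apply: Rpos; rewrite inE Ra' orbT.
have a0 : 0 <= pairing c a by apply: Rpos; rewrite inE eqxx.
have := IHR _ _ Rpos' nzk; rewrite pairingB pairingMn subr_ge0.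
by apply: le_trans; rewrite mulrn_wge0.
Qed.

(** * Reversal with negation *)

(** This is [- w_0] for the longest element [w_0] of ['S_m]: it permutes the positive roots of type
    A and sends each [- (eps r + eps s)] to a positive root. *)
Definition negrev m (v : 'rV[int]_m) : 'rV[int]_m := \row_i - v 0 (rev_ord i).

Lemma negrevK m : involutive (@negrev m).
Proof. by move=> v; apply/rowP => i; rewrite !mxE rev_ordK opprK. Qed.

Lemma negrevB m (a c : 'rV[int]_m) : negrev (a - c) = negrev a - negrev c.
Proof. by apply/rowP => i; rewrite !mxE opprD. Qed.

Lemma negrevD m (a c : 'rV[int]_m) : negrev (a + c) = negrev a + negrev c.
Proof. by apply/rowP => i; rewrite !mxE opprD. Qed.

Lemma negrevN m (a : 'rV[int]_m) : negrev (- a) = - negrev a.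
Proof. by apply/rowP => i; rewrite !mxE. Qed.

Lemma negrev_eps m (i : 'I_m) : negrev (eps i) = - eps (rev_ord i).
Proof.
apply/rowP => j; rewrite !mxE eqxx /= (inv_eq (@rev_ordK m)); congr (- _%:R).
Qed.

Definition swaprev m (p : 'I_m * 'I_m) := (rev_ord p.2, rev_ord p.1).

Lemma swaprevK m : involutive (@swaprev m).
Proof. by case=> i j; rewrite /swaprev /= !rev_ordK. Qed.

Lemma perm_swaprev m (P : pred ('I_m * 'I_m)) :
  (forall p, P (swaprev p) = P p) -> perm_eq [seq swaprev p | p <- enum P] (enum P).
Proof.
move=> Psw; apply: uniq_perm (enum_uniq _) _ => [|p].
  by rewrite map_inj_uniq ?enum_uniq //; apply: can_inj (@swaprevK m).
rewrite mem_enum; apply/mapP/idP => [[r Pr ->]|Pp].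
  by move: Pr; rewrite mem_enum !unfold_in Psw.
by exists (swaprev p); rewrite ?swaprevK // mem_enum unfold_in Psw.
Qed.

Lemma perm_exps_diff m :
  perm_eq [seq negrev a | a <- exps_diff m] (exps_diff m).
Proof.
rewrite /exps_diff /image_mem -map_comp.
rewrite (@eq_map _ _ _ ((fun p => eps p.1 - eps p.2) \o @swaprev m)).
  rewrite map_comp; apply/perm_map/perm_swaprev => -[i j] /=.
  by have := ltn_ord i; have := ltn_ord j; lia.
by case=> i j /=; rewrite negrevB !negrev_eps opprK addrC.
Qed.

Lemma perm_negrev_sum m (P : pred ('I_m * 'I_m)) :
    (forall p, P (swaprev p) = P p) ->
  perm_eq [seq negrev a | a <- [seq - a | a <- [seq eps p.1 + eps p.2 | p in P]]]
          [seq eps p.1 + eps p.2 | p in P].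
Proof.
move=> Psw; rewrite /image_mem -!map_comp.
rewrite (@eq_map _ _ _ ((fun p => eps p.1 + eps p.2) \o @swaprev m)).
  by rewrite map_comp; apply/perm_map/perm_swaprev.
by case=> i j /=; rewrite negrevN negrevD !negrev_eps -opprD opprK addrC.
Qed.

Lemma perm_exps_f m : perm_eq [seq negrev a | a <- exps_f m] (rootsD m).
Proof.
rewrite map_cat; apply: perm_cat; first exact: perm_exps_diff.
apply: perm_negrev_sum => -[i j] /=.
by have := ltn_ord i; have := ltn_ord j; lia.
Qed.

Lemma perm_exps_wsum m : perm_eq (exps_wsum m) (exps_sum m ++ exps_long m).
Proof.
have -> : exps_long m =
    [seq eps p.1 + eps p.2 | p : 'I_m * 'I_m <- [seq (i, i) | i <- enum 'I_m]].
  by rewrite -map_comp; apply: eq_map => i; rewrite mulr2n.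
rewrite -map_cat; apply: perm_map.
apply: uniq_perm (enum_uniq _) _ _ => [|[i j]].
  rewrite cat_uniq enum_uniq map_inj_uniq ?enum_uniq ?andbT => [|i j []//].
  by apply/hasPn => _ /mapP[i _ ->]; rewrite mem_enum inE /= ltnn.
rewrite mem_cat !mem_enum !inE /= leq_eqVlt orbC; congr (_ || _).
apply/eqP/mapP => [/val_inj ->|[k _ [-> ->]]//].
by exists j; rewrite ?mem_enum.
Qed.

Lemma perm_exps_F m : perm_eq [seq negrev a | a <- exps_F m] (rootsC m).
Proof.
rewrite map_cat; apply: perm_cat; first exact: perm_exps_diff.
apply: perm_trans (perm_exps_wsum m); apply: perm_negrev_sum => -[i j] /=.
by have := ltn_ord i; have := ltn_ord j; lia.
Qed.

Lemma f_q_negrev m (b : 'rV[int]_m) : f_q b = PD (negrev b).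
Proof.
apply/polyP => d; rewrite coef_f coef_PD -(perm_expansion (perm_exps_f m)).
by rewrite expansion_map //; [apply: negrevB | apply: can_inj (@negrevK m)].
Qed.

Lemma F_q_negrev m (b : 'rV[int]_m) : F_q b = PC (negrev b).
Proof.
apply/polyP => d; rewrite coef_F coef_PC -(perm_expansion (perm_exps_F m)).
by rewrite expansion_map //; [apply: negrevB | apply: can_inj (@negrevK m)].
Qed.

(** * Vanishing in negative weight *)

Lemma wt_pairing m (v : 'rV[int]_m) : pairing (fun=> 1) v = wt v.
Proof. by apply: eq_bigr => i _; rewrite mul1r. Qed.

Lemma PD_wt_lt0 m (b : 'rV[int]_m) : wt b < 0 -> PD b = 0.
Proof.
move=> b_lt0; apply/polyP => d; rewrite coef_PD coef0; apply/eqP.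
apply: contraTT b_lt0 => /(@expansion_supp _ (fun=> 1)); rewrite -leNgt wt_pairing.
apply=> a; rewrite mem_cat => /orP[] /imageP[[i j] _ ->];
  by rewrite ?pairingB ?pairingD !pairing_eps.
Qed.

Lemma PC_wt_lt0 m (b : 'rV[int]_m) : wt b < 0 -> PC b = 0.
Proof.
move=> b_lt0; apply/polyP => d; rewrite coef_PC coef0; apply/eqP.
apply: contraTT b_lt0 => /(@expansion_supp _ (fun=> 1)); rewrite -leNgt wt_pairing.
apply=> a; rewrite !mem_cat.
case/or3P=> [/imageP[[i j] _ ->]|/imageP[[i j] _ ->]|/imageP[i _ ->]];
  by rewrite ?pairingB ?pairingD ?pairingMn !pairing_eps.
Qed.

(** * Coxeter length and sign in the symmetric group *)

Lemma mem_coxlen (gT : finGroupType) (S : {set gT}) (w : gT) :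
  w \in <<S>>%g -> w \in (S ^+ coxlen S w)%g.
Proof.
by rewrite /coxlen; case: {-}_ / idP => [Sw _|//]; case: ex_minnP.
Qed.

Lemma gen_gensA m : <<gensA m>>%g = [set: 'S_m].
Proof.
(* Induction on the gap: conjugating [tperm i k] by the adjacent transposition of [k] and [k + 1]
   widens it by one. *)
have gen_lt d (i j : 'I_m) : j = (i + d).+1 :> nat -> tperm i j \in <<gensA m>>%g.
  elim: d j => [|d IHd] j ej.
    by apply/mem_gen/imsetP; exists (i, j); rewrite // inE /= ej addn0.
  have lt_k : ((i + d).+1 < m)%N by have := ltn_ord j; lia.
  pose k := Ordinal lt_k.
  have Sik : tperm i k \in <<gensA m>>%g by apply: IHd.
  have Skj : tperm k j \in <<gensA m>>%g.
    by apply/mem_gen/imsetP; exists (k, j); rewrite // inE /= ej addnS.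
  have -> : tperm i j = (tperm i k ^ tperm k j)%g.
    by rewrite tpermJ tpermL tpermD // -val_eqE /= ?ej; lia.
  by rewrite groupJ.
have gen i j : tperm i j \in <<gensA m>>%g.
  case: (ltngtP i j) => [lt_ij|lt_ji|/val_inj ->]; last by rewrite tperm1 group1.
    by apply: (gen_lt (j - i).-1); lia.
  by rewrite tpermC; apply: (gen_lt (i - j).-1); lia.
apply/setP => s; rewrite inE; have [ts -> _] := prod_tpermP s.
by apply: group_prod => t _.
Qed.

Lemma sign_coxlenA m (s : 'S_m) :
  (-1) ^+ coxlen (gensA m) s = (-1) ^+ s :> {poly int}.
Proof.
have: s \in <<gensA m>>%g by rewrite gen_gensA inE.
move/mem_coxlen; move: (coxlen _ _) => n sn.
suff -> : odd_perm s = odd n by rewrite signr_odd.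
elim: n s sn => [|n IHn] s; first by rewrite expg0 inE => /eqP ->; rewrite odd_perm1.
rewrite expgSr => /mulsgP[t _ /IHn tn /imsetP[[i j] ij ->] ->].
rewrite odd_permM tn odd_tperm /= addbC; rewrite inE /= in ij.
suff -> : i != j by [].
by rewrite -val_eqE /=; lia.
Qed.

(** * Signed permutations *)

Definition covers m (w : {perm signed_idx m}) (s : 'S_m) :=
  forall p, (w p).1 = s p.1.

Definition unsigned m (s : 'S_m) (p : signed_idx m) := (s p.1, p.2).

Lemma unsigned_inj m (s : 'S_m) : injective (unsigned s).
Proof. by case=> [i b] [j c] [/perm_inj -> ->]. Qed.

Definition lift_sgn m (s : 'S_m) : {perm signed_idx m} := perm (@unsigned_inj m s).

Lemma lift_sgnE m (s : 'S_m) p : lift_sgn s p = (s p.1, p.2).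
Proof. by rewrite permE. Qed.

Lemma lift_sgnM m (s t : 'S_m) :
  lift_sgn (s * t) = (lift_sgn s * lift_sgn t)%g.
Proof. by apply/permP => p; rewrite permM !lift_sgnE permM. Qed.

Lemma lift_sgn1 m : lift_sgn (1%g : 'S_m) = 1%g.
Proof. by apply/permP => -[i b]; rewrite lift_sgnE !perm1. Qed.

Lemma lift_sgnV m (s : 'S_m) : (lift_sgn s)^-1%g = lift_sgn s^-1%g.
Proof.
by apply: (mulgI (lift_sgn s)); rewrite mulgV -lift_sgnM mulgV lift_sgn1.
Qed.

Lemma lift_sgn_inj m : injective (@lift_sgn m).
Proof.
move=> s t /permP st; apply/permP => i.
by have := st (i, false); rewrite !lift_sgnE => -[].
Qed.

Lemma refl_diffE m (i j : 'I_m) : refl_diff i j = lift_sgn (tperm i j).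
Proof.
have pair_inj (c : bool) : injective (fun k : 'I_m => (k, c)) by move=> k l [].
have skip c k : tperm (i, c) (j, c) (k, ~~ c) = (k, ~~ c).
  by rewrite tpermD // xpair_eqE; case: c; rewrite andbF.
apply/permP => -[k []]; rewrite permM lift_sgnE /=.
  by rewrite (skip false) -(inj_tperm _ _ _ (pair_inj true)).
by rewrite -(inj_tperm _ _ _ (pair_inj false)) (skip true).
Qed.

Lemma odd_refl_diff m (i j : 'I_m) : odd_perm (refl_diff i j) = false.
Proof. by rewrite odd_permM !odd_tperm !xpair_eqE !eqxx !andbT addbb. Qed.

Lemma lift_sgn_gen m (s : 'S_m) : lift_sgn s \in <<gensCD m>>%g.
Proof.
have: s \in <<gensA m>>%g by rewrite gen_gensA inE.
move/mem_coxlen; move: (coxlen _ _) => n.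
elim: n s => [|n IHn] s; first by rewrite expg0 inE => /eqP ->; rewrite lift_sgn1.
rewrite expgSr => /mulsgP[t _ /IHn tn /imsetP[p pP ->] ->].
by rewrite lift_sgnM -refl_diffE groupM // mem_gen //; apply/imsetP; exists p.
Qed.

(** Each transposition acts once on the positive and once on the negative indices, hence evenly. *)
Lemma odd_lift_sgn m (s : 'S_m) : odd_perm (lift_sgn s) = false.
Proof.
have [ts -> _] := prod_tpermP s.
elim: ts => [|t ts IHts]; first by rewrite big_nil lift_sgn1 odd_perm1.
by rewrite big_cons lift_sgnM odd_permM IHts -refl_diffE odd_refl_diff.
Qed.

(* The sign character of the Weyl groups is the sign of the underlying        *)
(* permutation of coordinates times (-1) to the number of sign changes; the   *)
(* latter factor is also the sign of w as a permutation of the 2m signed      *)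
(* indices.                                                                   *)
Definition refl_like m (w : {perm signed_idx m}) :=
  exists2 s : 'S_m, covers w s & odd_perm s (+) odd_perm w.

Lemma refl_like_diff m (i j : 'I_m) : i != j -> refl_like (refl_diff i j).
Proof.
move=> nij; exists (tperm i j); last by rewrite odd_refl_diff odd_tperm nij.
by move=> p; rewrite refl_diffE lift_sgnE.
Qed.

Lemma refl_like_long m (i : 'I_m) : refl_like (refl_long i).
Proof.
exists 1%g; last by rewrite odd_perm1 odd_tperm xpair_eqE andbF.
by move=> p; rewrite perm1; case: tpermP => [->|->|].
Qed.

Lemma refl_like_sum m (i j : 'I_m) : i != j -> refl_like (refl_sum i j).
Proof.
move=> nij; exists (tperm i j); last first.
  by rewrite odd_permM !odd_tperm !xpair_eqE !andbF addbb nij.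
move=> [k b]; rewrite permM /=.
have nji : (j == i) = false by rewrite eq_sym (negbTE nij).
move/negbTE: nij => nij.
case: (tpermP i j k) => [->|->|/eqP nki /eqP nkj]; last first.
- by rewrite !tpermD ?xpair_eqE ?[_ == k]eq_sym ?(negbTE nki) ?(negbTE nkj).
- case: b; first by rewrite tpermR tpermD ?xpair_eqE ?andbF ?nij ?nji.
  by rewrite [tperm (i, false) _ _]tpermD ?xpair_eqE ?andbF ?nij ?nji // tpermR.
- case: b; last by rewrite tpermL tpermD ?xpair_eqE ?andbF ?nij ?nji.
  by rewrite [tperm (i, false) _ _]tpermD ?xpair_eqE ?andbF ?nij ?nji // tpermL.
Qed.

Lemma refl_like_gensCD m w : w \in gensCD m -> refl_like w.
Proof.
case/imsetP=> [[i j] ij ->]; apply: refl_like_diff.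
by rewrite inE /= in ij; rewrite -val_eqE /=; lia.
Qed.

Lemma refl_like_gensC m w : w \in gensC m -> refl_like w.
Proof.
case/setUP=> [/refl_like_gensCD //|/imsetP[i _ ->]]; exact: refl_like_long.
Qed.

Lemma refl_like_gensD m w : w \in gensD m -> refl_like w.
Proof.
case/setUP=> [/refl_like_gensCD //|/imsetP[[i j] ij ->]]; apply: refl_like_sum.
by rewrite inE /= in ij; rewrite -val_eqE /=; lia.
Qed.

(** The sign character takes the value -1 on each generator, so its value on a word of length [n] is
    the parity of [n]. On a lift, which is even on the signed indices, it reduces to the sign of
    [s]. *)
Lemma sign_coxlen_lift m (S : {set {perm signed_idx m}}) (s : 'S_m) :
    gensCD m \subset S -> (forall w, w \in S -> refl_like w) ->
  (-1) ^+ coxlen S (lift_sgn s) = (-1) ^+ s :> {poly int}.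
Proof.
move=> sub reflS; have: lift_sgn s \in <<S>>%g.
  by apply: subsetP (genS sub) _ (lift_sgn_gen _).
move/mem_coxlen; move: (coxlen _ _) => n sn.
(* Prefixes of the word need not be lifts, so the induction runs over any product of [n] generators
   and carries the covered permutation along. *)
suff [t cov_t odd_t] : exists2 t : 'S_m,
    covers (lift_sgn s) t & odd_perm t (+) odd_perm (lift_sgn s) = odd n.
  have <- : t = s by apply/permP => i; have := cov_t (i, false); rewrite lift_sgnE.
  by rewrite odd_lift_sgn addbF in odd_t; rewrite odd_t signr_odd.
elim: n (lift_sgn s) sn => [|n IHn] w.
  rewrite expg0 inE => /eqP ->; exists 1%g; last by rewrite !odd_perm1.
  by move=> p; rewrite !perm1.
rewrite expgSr => /mulsgP[x y /IHn[t cov_t odd_t] /reflS[r cov_r odd_r] ->].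
exists (t * r)%g => [p|]; first by rewrite !permM cov_r cov_t.
by rewrite !odd_permM addbACA odd_t odd_r addbT.
Qed.

(** * Signed action, weights and reduction to unsigned elements *)

Lemma weylact_lift m (s : 'S_m) (v : 'rV[int]_m) :
  weylact (lift_sgn s) v = permact s v.
Proof. by apply/rowP => j; rewrite !mxE lift_sgnV lift_sgnE /= expr0 mul1r. Qed.

Lemma weylC_neg {m} {w : {perm signed_idx m}} {i} b :
  w \in weylC m -> w (i, b) = ((w (i, false)).1, b (+) (w (i, false)).2).
Proof.
rewrite inE => /forallP/(_ (i, false))/eqP w_neg.
case: b; last by rewrite /=; case: (w _).
by have := w_neg; rewrite /negidx /=.
Qed.

Lemma weylC_abs_inj m (w : {perm signed_idx m}) :
  w \in weylC m -> injective (fun i => (w (i, false)).1).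
Proof.
move=> Ww i j /= eij.
have [eb|nb] := eqVneq (w (i, false)).2 (w (j, false)).2.
  suff: w (i, false) = w (j, false) by move/perm_inj => [].
  by case: (w _) (w _) eij eb => [a b] [c d] /= -> ->.
suff: w (i, false) = w (j, true) by move/perm_inj => [].
rewrite (weylC_neg true Ww) -eij.
by case: (w (i, false)) nb => a b /=; case: (w (j, false)).2; case: b.
Qed.

Lemma lift_sgn_weylC m (s : 'S_m) : lift_sgn s \in weylC m.
Proof. by rewrite inE; apply/forallP => p; rewrite !lift_sgnE. Qed.

Lemma lift_sgn_weylD m (s : 'S_m) : lift_sgn s \in weylD m.
Proof.
rewrite inE lift_sgn_weylC (_ : [set i | _] = set0) ?cards0 //.
by apply/setP => i; rewrite !inE lift_sgnE.
Qed.

Lemma weylC_lift_sgn m (w : {perm signed_idx m}) :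
    w \in weylC m -> (forall i, ~~ (w (i, false)).2) ->
  exists s : 'S_m, w = lift_sgn s.
Proof.
move=> Ww pos; exists (perm (weylC_abs_inj Ww)); apply/permP => -[i b].
by rewrite lift_sgnE permE /= (weylC_neg b Ww) (negbTE (pos i)) addbF.
Qed.

Lemma wt_weylact m (w : {perm signed_idx m}) (v : 'rV[int]_m) :
    w \in weylC m ->
  wt (weylact w v) = \sum_i (-1) ^+ (w (i, false)).2 * v 0 i.
Proof.
move=> Ww; rewrite /wt (reindex_inj (weylC_abs_inj Ww)).
apply: eq_bigr => i _; rewrite mxE.
suff -> : (w^-1)%g ((w (i, false)).1, false) = (i, (w (i, false)).2) by [].
by apply: (@perm_inj _ w); rewrite permKV (weylC_neg _ Ww) addbb.
Qed.

(** The sign change at [i] costs exactly twice that coordinate; the others can only lower the weight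
    further. *)
Lemma wt_weylact_le m (w : {perm signed_idx m}) (v : 'rV[int]_m) i :
    w \in weylC m -> (forall j, 0 <= v 0 j) -> (w (i, false)).2 ->
  wt (weylact w v) <= wt v - v 0 i *+ 2.
Proof.
move=> Ww v_ge0 wi; rewrite wt_weylact // /wt (bigD1 i) // [in leRHS](bigD1 i) //= wi expr1 mulN1r.
set S := (X in _ + X <= _); set T := (X in _ <= _ + X - _).
suff le_ST : S <= T by lia.
apply: ler_sum => j _; have := v_ge0 j.
by case: (w _).2; rewrite ?expr0 ?expr1; lia.
Qed.

Lemma sum_weyl_lift m (W S : {set {perm signed_idx m}})
    (P : 'rV[int]_m -> {poly int}) (x y : 'rV[int]_m) :
    W \subset weylC m -> (forall s, lift_sgn s \in W) ->
    gensCD m \subset S -> (forall w, w \in S -> refl_like w) ->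
    (forall w i, w \in W -> (w (i, false)).2 -> P (weylact w x - y) = 0) ->
  \sum_(w in W) (-1) ^+ coxlen S w * P (weylact w x - y) =
  \sum_(s : 'S_m) (-1) ^+ s * P (permact s x - y).
Proof.
move=> /subsetP subW liftW subS reflS P0.
rewrite (bigID (mem [set lift_sgn s | s in 'S_m])) /= [X in _ + X]big1 ?addr0.
  rewrite (eq_bigl (mem [set lift_sgn s | s in 'S_m])) => [|w]; last first.
    by apply: andb_idl => /imsetP[s _ ->].
  rewrite big_imset /=; last by move=> s t _ _; apply: lift_sgn_inj.
  by apply: eq_bigr => s _; rewrite sign_coxlen_lift // weylact_lift.
move=> w /andP[Ww /negP notl].
have [i wi|pos] := pickP (fun i => (w (i, false)).2).
  by rewrite (P0 w i) ?mulr0.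
case: notl; have [|s ->] := weylC_lift_sgn (subW _ Ww).
  by move=> i; rewrite pos.
exact: imset_f.
Qed.

(** * Comparison of the arguments *)

Lemma wtB m (a c : 'rV[int]_m) : wt (a - c) = wt a - wt c.
Proof. by rewrite -!wt_pairing pairingB. Qed.

Lemma wt_negrev m (v : 'rV[int]_m) : wt (negrev v) = - wt v.
Proof.
rewrite /wt (reindex_inj rev_ord_inj) -sumrN.
by apply: eq_bigr => i _; rewrite mxE rev_ordK.
Qed.

(** Negation commutes with permutations, and reversal is itself a permutation, so it acts by
    conjugation. *)
Lemma negrev_permact m (s : 'S_m) (v : 'rV[int]_m) :
  negrev (permact s v) = permact (s ^ perm (@rev_ord_inj m)) (negrev v).
Proof.
apply/rowP => j; rewrite !mxE; congr (- v 0 _).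
apply: (@perm_inj _ s); rewrite permKV; set t := (s ^ _)%g.
rewrite -{1}[j](permKV t); set k := _ j.
have -> : t k = rev_ord (s (rev_ord k)).
  by rewrite -{1}[k]rev_ordK -{1}(permE (@rev_ord_inj m)) permJ permE.
by rewrite rev_ordK.
Qed.

Lemma permact_shift m (s : 'S_m) (v w : 'rV[int]_m) (c : int) :
  permact s (v + const_mx c) - (w + const_mx c) = permact s v - w.
Proof. by apply/rowP => j; rewrite !mxE; ring. Qed.

Lemma sum_perm_negrev m (P Q : 'rV[int]_m -> {poly int}) (x y r x' y' : 'rV[int]_m)
    (c : int) :
    (forall b, P b = Q (negrev b)) ->
    x' = negrev x + const_mx c -> y' = negrev (y + r) + const_mx c ->
  \sum_(s : 'S_m) (-1) ^+ coxlen (gensA m) s * P (permact s x - y - r) =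
  \sum_(s : 'S_m) (-1) ^+ s * Q (permact s x' - y').
Proof.
move=> PQ -> ->; rewrite [RHS](reindex_inj (@conjg_inj _ (perm (@rev_ord_inj m)))).
apply: eq_bigr => s _; rewrite sign_coxlenA odd_permJ PQ !negrevB negrev_permact.
by rewrite permact_shift negrevD opprD addrA.
Qed.

Lemma wt_flip_lt0 m (w : {perm signed_idx m}) (x y : 'rV[int]_m) (k : int) i :
    w \in weylC m -> (forall j, 0 <= x 0 j) -> wt x - wt y <= k *+ 2 ->
    (w (i, false)).2 -> k < x 0 i ->
  wt (weylact w x - y) < 0.
Proof.
move=> Ww x_ge0 le_k wi lt_k; rewrite wtB.
by have := wt_weylact_le Ww x_ge0 wi; lia.
Qed.

Lemma hat_rho m (n k : int) (lam : 'rV[int]_m) :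
  hat n lam + k *: kappa m + rho m =
  negrev (lam + rho m) + const_mx (n + k + m%:Z + 1).
Proof.
apply/rowP => i; rewrite !mxE /=.
by have := ltn_ord i; lia.
Qed.

Lemma hat_rhoD m (n k : int) (lam : 'rV[int]_m) :
  hat n lam + k *: kappa m + rhoD m =
  negrev (lam + rho m) + const_mx (n + k + m%:Z).
Proof.
apply/rowP => i; rewrite !mxE /=.
by have := ltn_ord i; lia.
Qed.

(** Sign changes come in even number, so there is a second one, and at most one of the two is at the
    last coordinate, where [rhoD] is zero. *)
Lemma weylD_flip m (w : {perm signed_idx m}) i :
    w \in weylD m -> (w (i, false)).2 ->
  exists2 j : 'I_m, (w (j, false)).2 & (j.+1 < m)%N.
Proof.
rewrite inE => /andP[_]; set I := [set _ | _] => evI wi.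
have Ii : i \in I by rewrite inE.
have [j /setD1P[nji]] : exists j, j \in I :\ i.
  apply/set0Pn; apply: contraNneq evI => I0.
  by rewrite (cardsD1 i I) Ii I0 cards0.
rewrite inE => wj; have := ltn_ord i; have := ltn_ord j.
have [ltj _ _|] := ltnP j.+1 m; first by exists j.
by exists i => //; move: nji; rewrite -val_eqE /=; lia.
Qed.

Lemma hat_partition m (n : int) (lam : 'rV[int]_m) :
  is_partition lam -> (forall i, lam 0 i <= n) -> is_partition (hat n lam).
Proof.
move=> [lam_mono _] lam_le; split=> [i j le_ij|i]; rewrite !mxE; last first.
  by rewrite subr_ge0.
by rewrite lerD2l lerN2 lam_mono //= leq_sub2l.
Qed.

Theorem theorem5p1p5 (m : nat) (m_ge1 : (0 < m)%N) (lam mu : 'rV[int]_m)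
    (lam_part : is_partition lam) (mu_part : is_partition mu) (n : int)
    (n_def : n = Num.max (lam 0 (Ordinal m_ge1)) (mu 0 (Ordinal m_ge1)))
    (k : int) (k_ge : (wt mu - wt lam)%:~R / 2%:R <= k%:~R :> rat)
    (lamk_part : is_partition (hat n lam + k *: kappa m))
    (muk_part : is_partition (hat n mu + k *: kappa m)) :
  [/\ is_partition (hat n lam), is_partition (hat n mu),
      u_q lam mu = KD (hat n lam + k *: kappa m) (hat n mu + k *: kappa m)
    & U_q lam mu = KC (hat n lam + k *: kappa m) (hat n mu + k *: kappa m)].
Proof.
have lam_le i : lam 0 i <= n by rewrite n_def le_max (lam_part.1 (Ordinal m_ge1)).
have mu_le i : mu 0 i <= n by rewrite n_def le_max orbC (mu_part.1 (Ordinal m_ge1)).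
have hatl := hat_partition lam_part lam_le.
have le_k : wt mu - wt lam <= k *+ 2.
  by rewrite -(ler_int rat) rmorphMn /= -mulr_natr -ler_pdivrMr.
set nu : 'rV[int]_m := hat n lam + _ in lamk_part *.
set eta : 'rV[int]_m := hat n mu + _ in muk_part *.
have nu_ge i : k <= nu 0 i by have := hatl.2 i; rewrite !mxE /=; lia.
(* The constants cancel and [negrev] negates the weight, so the difference is [wt mu - wt lam]. *)
have wt_diff c x y : x = negrev (lam + rho m) + const_mx c ->
    y = negrev (mu + rho m) + const_mx c -> wt x - wt y <= k *+ 2.
  move=> -> ->; rewrite -wtB (_ : _ - _ = negrev (lam - mu)).
    by rewrite wt_negrev wtB opprB.
  by apply/rowP => i; rewrite !mxE; ring.
have eqDl : nu + rhoD m = _ := hat_rhoD n k lam.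
have eqDm : eta + rhoD m = _ := hat_rhoD n k mu.
have eqCl : nu + rho m = _ := hat_rho n k lam.
have eqCm : eta + rho m = _ := hat_rho n k mu.
clearbody nu eta.
have nu_rhoD i : (nu + rhoD m) 0 i = nu 0 i + (m - i.+1)%N%:Z by rewrite !mxE.
have nu_rho i : (nu + rho m) 0 i = nu 0 i + (m - i)%N%:Z by rewrite !mxE.
split=> //; first exact: hat_partition.
  rewrite /u_q (sum_perm_negrev (@f_q_negrev m) eqDl eqDm); apply/esym/sum_weyl_lift.
  - by apply/subsetP => w /setIdP[].
  - exact: lift_sgn_weylD.
  - exact: subsetUl.
  - exact: refl_like_gensD.
  move=> w i Ww /(weylD_flip Ww)[j wj lt_j]; apply: PD_wt_lt0.
  apply: (wt_flip_lt0 (k := k) (i := j)) => //.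
  - by case/setIdP: Ww.
  - by move=> l; have := lamk_part.2 l; rewrite nu_rhoD; lia.
  - exact: (wt_diff _ _ _ eqDl eqDm).
  (* Strictness comes from [rhoD], which is positive at [j] since [j] is not the last index. *)
  by have := nu_ge j; rewrite nu_rhoD; lia.
rewrite /U_q (sum_perm_negrev (@F_q_negrev m) eqCl eqCm); apply/esym/sum_weyl_lift.
- exact: subxx.
- exact: lift_sgn_weylC.
- exact: subsetUl.
- exact: refl_like_gensC.
move=> w i Ww wi; apply: PC_wt_lt0.
apply: (wt_flip_lt0 (k := k) (i := i)) => //.
- by move=> l; have := lamk_part.2 l; rewrite nu_rho; lia.
- exact: (wt_diff _ _ _ eqCl eqCm).
(* In type C every coordinate of [rho] is positive, so any sign change suffices. *)
by have := nu_ge i; have := ltn_ord i; rewrite nu_rho; lia.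
Qed.
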